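(* Let $m\ge 1$ be an integer, let $O_{m+1}$ be the Odd graph with vertex set $X=\binom{\Omega}{m}$, $|\Omega|=2m+1$, and fix a vertex $x\in X$. Let $\mathcal{T}=\mathcal{T}(x)$ be the Terwilliger algebra of $O_{m+1}$ with respect to $x$, and let $\mathcal{M}=\bigoplus_{p,q=0}^{m}L(\mathcal{M}_{p,q})\subseteq \mathrm{Mat}_X(\mathbb{C})$ be the algebra defined in the context. Then $\mathcal{T}=\mathcal{M}$.
   Context: Odd graph. $\Omega$ is a set with $|\Omega|=2m+1$, and $\binom{\Omega}{i}$ is the set of $i$-subsets of $\Omega$. The Odd graph $O_{m+1}$ has vertex set $X=\binom{\Omega}{m}$, two vertices being adjacent iff they are disjoint. It is connected with diameter $m$. Let $A\in\mathrm{Mat}_X(\mathbb{C})$ be its adjacency matrix, $\partial$ its distance function and $\Gamma_i(x)=\{y\in X: \partial(x,y)=i\}$. One has $\partial(x,y)=2i$ iff $|x\cap y|=m-i$ (for $0\le 2i\le m$) and $\partial(x,y)=2i+1$ iff $|x\cap y|=i$ (for $1\le 2i+1\le m$). Terwilliger algebra. For $0\le i\le m$, $E_i^*=E_i^*(x)$ is the diagonal matrix in $\mathrm{Mat}_X(\mathbb{C})$ with $(y,y)$-entry $1$ if $y\in\Gamma_i(x)$ and $0$ otherwise. $\mathcal{T}(x)$ is the subalgebra of $\mathrm{Mat}_X(\mathbb{C})$ generated by $A,E_0^*,\dots,E_m^*$. Intersection matrices. For a set $V$ with $|V|=v$, $H_{i,j}^l(v)$ is the 0-1 matrix with rows indexed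 by $\binom{V}{i}$ and columns indexed by $\binom{V}{j}$, whose $(y,z)$-entry is $1$ iff $|y\cap z|=l$. Put $G_{i,j}(v)=\{g\in\mathbb{Z}: \max(0,i+j-v)\le g\le \min(i,j)\}$. In a Kronecker product $H_{a,b}^l(m)\otimes H_{c,d}^s(m+1)$ the first factor is taken with $V=x$ and the second with $V=\Omega\setminus x$; when $a+c=b+d=m$, its rows, indexed by pairs $(\alpha,\beta)\in\binom{x}{a}\times\binom{\Omega\setminus x}{c}$, are identified with the vertices $y=\alpha\cup\beta$, i.e. with the $y\in X$ such that $|x\cap y|=a$, and similarly its columns with the $z\in X$ such that $|x\cap z|=b$. The space $\mathcal{M}$. For a matrix $M$ with rows indexed by $\Gamma_p(x)$ and columns by $\Gamma_q(x)$, $L(M)\in\mathrm{Mat}_X(\mathbb{C})$ is the matrix whose $\Gamma_p(x)\times\Gamma_q(x)$ block is $M$ and whose other entries are $0$. For $0\le p,q\le m$ the complex vector spaces $\mathcal{M}_{p,q}$ of matrices indexed by $\Gamma_p(x)\times\Gamma_q(x)$ are defined (for all $i,j\ge 0$ for which the indices $p,q$ lie in $\{0,\dots,m\}$) by $$\mathcal{M}_{2i,2j}=\mathrm{Span}\{H_{m-i,m-j}^l(m)\otimes H_{i,j}^s(m+1): l\in G_{m-i,m-j}(m),\ s\in G_{i,j}(m+1)\},$$ $$\mathcal{M}_{2i,2j+1}=\mathrm{Span}\{H_{m-i,j}^l(m)\otimes H_{i,m-j}^s(m+1): l\in G_{m-i,j}(m),\ s\in G_{i,m-j}(m+1)\},$$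 $$\mathcal{M}_{2i+1,2j}=\mathrm{Span}\{H_{i,m-j}^l(m)\otimes H_{m-i,j}^s(m+1): l\in G_{i,m-j}(m),\ s\in G_{m-i,j}(m+1)\},$$ $$\mathcal{M}_{2i+1,2j+1}=\mathrm{Span}\{H_{i,j}^l(m)\otimes H_{m-i,m-j}^s(m+1): l\in G_{i,j}(m),\ s\in G_{m-i,m-j}(m+1)\}.$$ Then $L(\mathcal{M}_{p,q})=\{L(M): M\in\mathcal{M}_{p,q}\}$ and $\mathcal{M}=\bigoplus_{p,q=0}^m L(\mathcal{M}_{p,q})$; $\mathcal{M}$ is closed under multiplication, hence an algebra. *)

(* Defs.v *)
From HB Require Import structures.
From mathcomp Require Export all_boot all_order all_algebra.
From mathcomp Require Export all_classical reals.
From mathcomp Require Export complex mxtens.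

Set Implicit Arguments.
Unset Strict Implicit.
Unset Printing Implicit Defensive.

Import GRing.Theory.
Local Open Scope ring_scope.

(* A matrix over F with rows and columns indexed by finite types I and J is
   rendered as 'M[F]_(#|I|, #|J|), and likewise for finite sets, the row number
   r standing for the index enum_val r. *)

(** Distance in a finite graph *)

(* Least length of a walk from x to y.  A shortest walk has fewer than #|T|
   edges; the value is #|T| when there is no walk. *)
Definition gdist (T : finType) (e : rel T) (x y : T) : nat :=
  find (fun n => [exists p : n.-tuple T, path e x p && (last x p == y)])
       (iota 0 #|T|).

(** The Odd graph *)

Definition odd_vertex (Omega : finType) (m : nat) : predArgType :=
  {y : {set Omega} | #|y| == m}.

Definition odd_adj (Omega : finType) (m : nat) : rel (odd_vertex Omega m) :=
  fun y z => [disjoint val y & val z].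

Definition Gamma (Omega : finType) (m : nat) (x : odd_vertex Omega m) (i : nat)
    : {set odd_vertex Omega m} :=
  [set y | gdist (@odd_adj Omega m) x y == i].

Definition adj_mx (F : fieldType) (Omega : finType) (m : nat)
    : 'M[F]_#|odd_vertex Omega m| :=
  \matrix_(r, c) (odd_adj (enum_val r) (enum_val c))%:R.

Definition Estar (F : fieldType) (Omega : finType) (m : nat)
    (x : odd_vertex Omega m) (i : nat) : 'M[F]_#|odd_vertex Omega m| :=
  \matrix_(r, c) ((r == c) && (enum_val r \in Gamma x i))%:R.

(** The Terwilliger algebra *)

(* Written out because 'M[F]_n has an algebra instance only when n is
   syntactically a successor. *)
Definition is_subalgebra (F : fieldType) (n : nat) (S : set 'M[F]_n) : Prop :=
  [/\ S 1%:M,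
      forall (a : F) (M N : 'M[F]_n), S M -> S N -> S (a *: M + N) &
      forall M N : 'M[F]_n, S M -> S N -> S (M *m N)].

Definition terwilliger (F : fieldType) (Omega : finType) (m : nat)
    (x : odd_vertex Omega m) : set 'M[F]_#|odd_vertex Omega m| :=
  smallest (@is_subalgebra F #|odd_vertex Omega m|)
    [set B | B = adj_mx F Omega m \/ exists i : 'I_m.+1, B = Estar F x i].

Arguments terwilliger F {Omega m} x _.

(** Intersection matrices *)

Definition ksubsets (Omega : finType) (V : {set Omega}) (i : nat)
    : {set {set Omega}} :=
  [set a : {set Omega} | (a \subset V) && (#|a| == i)].

Definition Hmx (F : fieldType) (Omega : finType) (V : {set Omega})
    (i j l : nat) : 'M[F]_(#|ksubsets V i|, #|ksubsets V j|) :=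
  \matrix_(r, c) (#|enum_val r :&: enum_val c| == l)%:R.

(* Truncated subtraction yields the lower bound max(0, i + j - v). *)
Definition Grange (i j v : nat) : seq nat :=
  index_iota (i + j - v) (minn i j).+1.

(** Identification of index sets *)

(* M with its entry at (r, c) moved to the position (r', c') whose labels agree:
   f r = f' r' and g c = g' c'.  Used with all labellings injective, so that
   each sum has at most one term and unmatched positions are filled with 0. *)
Definition relabel_mx (F : fieldType) (T U : eqType) (m n m' n' : nat)
    (f : 'I_m -> T) (g : 'I_n -> U) (f' : 'I_m' -> T) (g' : 'I_n' -> U)
    (M : 'M[F]_(m, n)) : 'M[F]_(m', n') :=
  \matrix_(r', c') \sum_(r < m | f r == f' r') \sum_(c < n | g c == g' c') M r c.

(* The row index (alpha, beta) of a Kronecker product, as alpha :|: beta. *)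
Definition tens_label (Omega : finType) (P Q : {set {set Omega}})
    (r : 'I_(#|P| * #|Q|)) : {set Omega} :=
  enum_val (mxtens_unindex r).1 :|: enum_val (mxtens_unindex r).2.

Definition vertex_label (Omega : finType) (m : nat)
    (Y : {set odd_vertex Omega m}) (r : 'I_#|Y|) : {set Omega} :=
  val (enum_val r).

(* H_{a,b}^l(m) (x) H_{c,d}^s(m+1), as a Gamma_p(x) x Gamma_q(x) matrix. *)
Definition HH_mx (F : fieldType) (Omega : finType) (m : nat)
    (x : odd_vertex Omega m) (p q a b c d l s : nat)
    : 'M[F]_(#|Gamma x p|, #|Gamma x q|) :=
  relabel_mx
    (@tens_label Omega (ksubsets (val x) a) (ksubsets (~: val x) c))
    (@tens_label Omega (ksubsets (val x) b) (ksubsets (~: val x) d))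
    (@vertex_label Omega m (Gamma x p)) (@vertex_label Omega m (Gamma x q))
    (tensmx (Hmx F (val x) a b l) (Hmx F (~: val x) c d s)).

(** The space M *)

(* The vertices y in Gamma_p(x) satisfy |y :&: x| = in_card m p and
   |y :\: x| = out_card m p: these are m - i and i for p = 2i, and i and m - i
   for p = 2i + 1. *)
Definition in_card (m p : nat) : nat := if odd p then p./2 else (m - p./2)%N.
Definition out_card (m p : nat) : nat := if odd p then (m - p./2)%N else p./2.

(* The four parity cases of (p, q) at once. *)
Definition Mblock (F : fieldType) (Omega : finType) (m : nat)
    (x : odd_vertex Omega m) (p q : nat)
    : {vspace 'M[F]_(#|Gamma x p|, #|Gamma x q|)} :=
  let a := in_card m p in let b := in_card m q in
  let c := out_card m p in let d := out_card m q in
  <<[seq HH_mx F x p q a b c d l s | l <- Grange a b m, s <- Grange c d m.+1]>>%VS.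

Definition Lmx (F : fieldType) (Omega : finType) (m : nat)
    (x : odd_vertex Omega m) (p q : nat)
    (M : 'M[F]_(#|Gamma x p|, #|Gamma x q|)) : 'M[F]_#|odd_vertex Omega m| :=
  relabel_mx
    (fun r : 'I_#|Gamma x p| => enum_val r) (fun c : 'I_#|Gamma x q| => enum_val c)
    (fun r : 'I_#|odd_vertex Omega m| => enum_val r)
    (fun c : 'I_#|odd_vertex Omega m| => enum_val c) M.

Definition Mspace (F : fieldType) (Omega : finType) (m : nat)
    (x : odd_vertex Omega m) : {vspace 'M[F]_#|odd_vertex Omega m|} :=
  (\sum_(pq : 'I_m.+1 * 'I_m.+1)
     (linfun (@Lmx F Omega m x pq.1 pq.2) @: Mblock F x pq.1 pq.2))%VS.

Arguments Mspace F {Omega m} x.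

(* linfun f agrees with f only when f is linear. *)
Fact relabel_mx_is_linear (F : fieldType) (T U : eqType) (m n m' n' : nat)
    (f : 'I_m -> T) (g : 'I_n -> U) (f' : 'I_m' -> T) (g' : 'I_n' -> U) :
  linear (@relabel_mx F T U m n m' n' f g f' g').
Proof.
move=> a A B; apply/matrixP => r' c'; rewrite !mxE mulr_sumr -big_split /=.
apply: eq_bigr => r _; rewrite mulr_sumr -big_split /=.
by apply: eq_bigr => c _; rewrite !mxE.
Qed.

HB.instance Definition _ (F : fieldType) (Omega : finType) (m : nat)
    (x : odd_vertex Omega m) (p q : nat) :=
  GRing.isLinear.Build F 'M[F]_(#|Gamma x p|, #|Gamma x q|)
    'M[F]_#|odd_vertex Omega m| *:%R (@Lmx F Omega m x p q)
    (@relabel_mx_is_linear F _ _ _ _ _ _ _ _ _ _).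

Fact LmxE (F : fieldType) (Omega : finType) (m : nat) (x : odd_vertex Omega m)
    (p q : nat) (M : 'M[F]_(#|Gamma x p|, #|Gamma x q|)) :
  linfun (@Lmx F Omega m x p q) M = Lmx M.
Proof. by rewrite lfunE. Qed.

(* The sum defining Mspace is direct. *)
Fact Mspace_direct (F : fieldType) (Omega : finType) (m : nat)
    (x : odd_vertex Omega m) :
  directv (\sum_(pq : 'I_m.+1 * 'I_m.+1)
     (linfun (@Lmx F Omega m x pq.1 pq.2) @: Mblock F x pq.1 pq.2))%VS.
Proof.
pose V (pq : 'I_m.+1 * 'I_m.+1) :=
  (linfun (@Lmx F Omega m x pq.1 pq.2) @: Mblock F x pq.1 pq.2)%VS.
have supp pq (B : 'M[F]_#|odd_vertex Omega m|) r c : B \in V pq -> B r c != 0 ->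
    enum_val r \in Gamma x pq.1 /\ enum_val c \in Gamma x pq.2.
  case/memv_imgP => N _ ->; rewrite LmxE mxE => nz.
  have [r0 /eqP <-|no_r] := pickP (fun r0 : 'I_#|Gamma x pq.1| =>
    enum_val r0 == enum_val r); last by rewrite big_pred0 ?eqxx in nz.
  have [c0 /eqP <-|no_c] := pickP (fun c0 : 'I_#|Gamma x pq.2| =>
    enum_val c0 == enum_val c); first by split; apply: enum_valP.
  by rewrite big1 ?eqxx // in nz => r1 _; rewrite big_pred0.
apply/directv_sum_independent => B inV sum0 pq _.
apply/matrixP => r c; rewrite mxE; apply/eqP; apply/negPn/negP => nz.
have [rp cq] := supp _ _ _ _ (inV pq isT) nz.
have /matrixP/(_ r c) := sum0; rewrite mxE summxE (bigD1 pq) //= big1 ?addr0.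
  by move/eqP; apply/negP.
move=> pq' ne; apply/eqP; apply/negPn/negP => nz'.
have [] := supp _ _ _ _ (inV pq' isT) nz'.
move: rp cq; rewrite !inE => /eqP -> /eqP -> /eqP e1 /eqP e2.
case/eqP: ne; case: pq pq' e1 e2 {nz nz'} => p q [p' q'] /= e1 e2.
by congr pair; apply: val_inj.
Qed.

(* Main.v *)
Require Import Defs.
From mathcomp Require Import finset zify ring.

Set Implicit Arguments.
Unset Strict Implicit.
Unset Printing Implicit Defensive.

Import Order.TTheory GRing.Theory Num.Theory.
Local Open Scope ring_scope.

(** Write [O a b l s] for the 0-1 matrix whose (y, z) entry is 1 exactly when
    |y :&: x| = a, |z :&: x| = b, |y :&: z :&: x| = l and |(y :&: z) :\: x| = s.
    The distance from x to y is a function of |y :&: x| alone, injective on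
    0, ..., m ([gdist_odd], [in_Gamma]), so that the matrices [L (H (x) H)]
    generating M are such matrices ([Lmx_HH]), and the Estar_i are the diagonal
    matrices [O a a a (m - a)].  Hence M is the span of the [O a b l s].

    Both inclusions rest on one computation.  The neighbours of a vertex w are
    the sets ~: w :\ e with e outside w, and the intersection sizes of y with
    such a neighbour follow from those of y with w and from whether e lies in x
    and in y ([sum_orbit_kernel_remove]).  Hence, with P_b the projection onto
    the vertices that meet x in b points (level b),

      [O a b l s A P_(m-b)] is a combination of [O a (m-b) (a-l) (m-a-s-1)]
        and [O a (m-b) (a-l) (m-a-s)]  (the point e is outside x), and
      [O a b l s A P_(m-b-1)] is a combination of
        [O a (m-b-1) (a-l-1) (m-a-s)] and [O a (m-b-1) (a-l) (m-a-s)]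
        (the point e is inside x),

    with explicit coefficients, and [O a b l s A] is the sum of the two.

    T is contained in M: the matrices B with M B contained in M form an algebra,
    which contains A by these formulas and obviously the Estar_i; since M
    contains 1, every such B lies in M ([terwilliger_sub_Mspace]).

    M is contained in T: the formulas are recurrences that can be solved for
    one of their terms, whose coefficient is a nonzero integer
    ([orbital_in_subalgebra]).  The route starts at
    [Estar = O a a a (m-a)].  The product P_a A P_(m-a) A P_a leaves the part
    inside x alone and moves one point outside x, which gives all [O a a a s];
    P_a A P_(m-a-1) A P_a does the same with the roles of x and its complement
    exchanged, which gives all [O a a l s] ([diag_orbital]).  Passing through
    level m - b, resp. m - b - 1, then moves the column level from b to b - 1
    when b <= a, resp. to b + 1 when b >= a ([orbital_step_down],
    [orbital_step_up]). *)

(** * Neighbours in the Odd graph *)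

Lemma card_setI_remove (Omega : finType) (A w : {set Omega}) e : e \notin w ->
  #|A :&: (~: w :\ e)|%:Z = #|A|%:Z - #|A :&: w|%:Z - (e \in A)%:Z.
Proof.
move=> ew; have -> : A :&: (~: w :\ e) = (A :\: w) :\ e.
  by rewrite setIDA -setDE.
by have := cardsD1 e (A :\: w); have := cardsID w A; rewrite in_setD ew /=; lia.
Qed.

Section OrbitKernels.

Variables (Omega : finType) (m : nat).
Hypothesis card_Omega : #|Omega| = (2 * m).+1%N.

Lemma card_vertex (y : odd_vertex Omega m) : #|val y| = m.
Proof. exact: (eqP (valP y)). Qed.

Lemma card_setC_vertex (y : odd_vertex Omega m) : #|~: val y| = m.+1.
Proof. by have := cardsC (val y); rewrite card_vertex card_Omega; lia. Qed.

Lemma odd_adjP (y z : odd_vertex Omega m) :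
  reflect (exists2 e, e \in ~: val z & val y = ~: val z :\ e) (odd_adj y z).
Proof.
apply: (iffP idP) => [dyz | [e ez yE]]; last first.
  by rewrite /odd_adj yE disjoints_subset subD1set.
have sub : val y \subset ~: val z by rewrite -disjoints_subset.
have /eqP/cards1P[e eE] : #|~: val z :\: val y| = 1%N.
  by rewrite cardsDS // card_setC_vertex card_vertex subSnn.
have /setDP[ez _] : e \in ~: val z :\: val y by rewrite eE set11.
exists e => //; rewrite -eE setDDr setDv set0U.
by apply/esym/setIidPr.
Qed.

(** The vertex w has m + 1 points outside it, so a vertex disjoint from w misses
    exactly one of them, and that point can be used as a summation index. *)
Lemma sum_neighbours (V : nmodType) (w : odd_vertex Omega m)
    (f : {set Omega} -> V) :
  \sum_(z | odd_adj z w) f (val z) = \sum_(e in ~: val w) f (~: val w :\ e).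
Proof.
pose h e := insubd w (~: val w :\ e).
have hE e : e \in ~: val w -> val (h e) = ~: val w :\ e.
  move=> ew; rewrite val_insubd; case: ifP => // /negP[].
  by have := card_setC_vertex w; rewrite (cardsD1 e) ew add1n => -[->].
rewrite (eq_bigl (mem (h @: ~: val w))) => [|z]; last first.
  apply/odd_adjP/imsetP => -[e ew zE]; exists e => //.
    by apply: val_inj; rewrite hE.
  by rewrite zE hE.
rewrite big_imset /= => [|e e' ew e'w eqh].
  by apply: eq_bigr => e ew; rewrite hE.
move/(congr1 val): eqh; rewrite !hE // => /setP/(_ e).
by rewrite !in_setD1 eqxx ew; case: eqP.
Qed.

Variable F : fieldType.

(** The intersection sizes are read as integers, so that the shifts of indices
    below involve no truncated subtraction and the identities they satisfy need
    no side conditions. *)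
Definition orbit_kernel (phi : int -> int -> int -> int -> F)
    (x y z : {set Omega}) : F :=
  phi #|y :&: x| #|z :&: x| #|y :&: z :&: x| #|y :&: z :\: x|.

(** The effect on phi of right multiplication by the adjacency matrix, on the
    sizes (a, b, l, s) of (y, w).  The four terms correspond to removing from
    ~: w a point of y :&: x, of x :\: y, of y :\: x, or outside x :|: y; the
    multiplicity counts the points of that kind outside w. *)
Definition orbit_adj (phi : int -> int -> int -> int -> F) (a b l s : int) : F :=
    phi a (m%:Z - b - 1) (a - l - 1) (m%:Z - a - s) *~ (a - l)
  + phi a (m%:Z - b - 1) (a - l) (m%:Z - a - s) *~ (m%:Z - b - (a - l))
  + phi a (m%:Z - b) (a - l) (m%:Z - a - s - 1) *~ (m%:Z - a - s)
  + phi a (m%:Z - b) (a - l) (m%:Z - a - s) *~ (b + 1 - (m%:Z - a - s)).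

Lemma sum_orbit_kernel_remove phi (x y w : {set Omega}) :
    #|x| = m -> #|y| = m -> #|w| = m ->
  \sum_(e in ~: w) orbit_kernel phi x y (~: w :\ e) =
  orbit_kernel (orbit_adj phi) x y w.
Proof.
move=> cx cy cw; pose f := orbit_kernel phi x y; rewrite -/f.
rewrite (bigID (mem x)) /= (bigID (mem y)) /= [X in _ + X](bigID (mem y)) /= addrA.
have := cardsID x y; rewrite cy => cyx.
have := cardsID x w; rewrite cw => cwx.
have cyw := cardsID x (y :&: w).
pose a := #|y :&: x|%:Z; pose b := #|w :&: x|%:Z.
pose l := #|y :&: w :&: x|%:Z.
pose s := #|y :&: w :\: x|%:Z.
have fE e : e \in ~: w -> f (~: w :\ e) =
  phi a (m%:Z - b - (e \in x)%:Z)
    (a - l - ((e \in y) && (e \in x))%:Z)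
    (m%:Z - a - s - ((e \in y) && (e \notin x))%:Z).
  rewrite in_setC => ew; rewrite /f -/a; congr phi.
  - by rewrite setIC card_setI_remove // cx (setIC _ w).
  - by rewrite setIAC card_setI_remove // setIAC in_setI.
  - rewrite -setIDAC card_setI_remove // setIDAC in_setD (andbC (e \in y)) /a /s.
    by congr (_ - _ - _); lia.
(* Each of the four sums has a constant summand c1; A is the set that the
   removed point is taken from. *)
have part (Q : pred Omega) (A : {set Omega}) c1 n1 :
    (forall e, Q e = (e \in A :\: w)) -> #|A|%:Z - #|A :&: w|%:Z = n1 ->
    (forall e, e \in ~: w -> e \in A -> f (~: w :\ e) = c1) ->
  \sum_(e | Q e) f (~: w :\ e) = c1 *~ n1.
  move=> QA <- fc; have -> : #|A|%:Z - #|A :&: w|%:Z = #|A :\: w|.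
    by have := cardsID w A; lia.
  rewrite -pmulrn -sumr_const; apply: eq_big => [//|e].
  by rewrite QA in_setD => /andP[ew eA]; rewrite fc // in_setC.
rewrite -[RHS]/(orbit_adj phi a b l s); congr (_ + _ + _ + _).
- apply: (part _ (y :&: x)) => [e||e ew].
  + by rewrite !inE; do 3!case: (_ \in _).
  + by rewrite setIAC.
  + by rewrite inE => /andP[ey ex]; rewrite fE // ex ey /= !subr0.
- apply: (part _ (x :\: y)) => [e||e ew].
  + by rewrite !inE; do 3!case: (_ \in _).
  + have := cardsID y x; have := cardsID y (x :&: w).
    rewrite setIDAC !(setIC x) (setIC (w :&: x)) setIA.
    by rewrite /a /b /l; lia.
  + by rewrite inE => /andP[ey ex]; rewrite fE // ex (negbTE ey) /= !subr0.
- apply: (part _ (y :\: x)) => [e||e ew].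
  + by rewrite !inE; do 3!case: (_ \in _).
  + by rewrite setIDAC /a /s; lia.
  + by rewrite inE => /andP[ex ey]; rewrite fE // ey (negbTE ex) /= !subr0.
- apply: (part _ (~: (x :|: y))) => [e||e ew].
  + by rewrite !inE; do 3!case: (_ \in _).
  + have := cardsC (x :|: y); have := cardsUI x y.
    have := cardsID (x :|: y) w; have := cardsUI (w :&: x) (w :&: y).
    rewrite (setIC (~: _)) -setDE -setIUr -setIIr (setIC x) card_Omega.
    by rewrite setIA (setIC w y) cx cy cw /a /b /s; lia.
  + rewrite !inE negb_or => /andP[ex ey].
    by rewrite fE // (negbTE ey) (negbTE ex) /= !subr0.
Qed.

Definition orbit_mx (x : odd_vertex Omega m) (phi : int -> int -> int -> int -> F)
    : 'M[F]_#|odd_vertex Omega m| :=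
  \matrix_(r, c) orbit_kernel phi (val x) (val (enum_val r)) (val (enum_val c)).

Lemma mul_orbit_adj x phi :
  orbit_mx x phi *m adj_mx F Omega m = orbit_mx x (orbit_adj phi).
Proof.
apply/matrixP => r c; rewrite !mxE -sum_orbit_kernel_remove ?card_vertex //.
rewrite -(sum_neighbours (enum_val c)).
rewrite [RHS](@big_enum_val_cond _ _ _ _ predT (fun z => odd_adj z _)).
rewrite [RHS]big_mkcond /=.
by apply: eq_bigr => k _; rewrite !mxE mulr_natr mulrb.
Qed.

End OrbitKernels.

(** * Distance from the base vertex *)

Section Distance.

Local Open Scope nat_scope.

(** Along a walk from x the values of f bound the length from below, and stepping
    back from y along decreasing values of f traces a walk of length f y. *)
Lemma gdist_potential (T : finType) (e : rel T) (x : T) (f : T -> nat) :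
    f x = 0%N -> (forall y z, e y z -> f z <= (f y).+1) ->
    (forall y, y != x -> exists2 z, e z y & f y = (f z).+1) ->
  forall y, (f y < #|T|)%N -> gdist e x y = f y.
Proof.
move=> fx0 lip desc y ltfT.
have walk_ge p : path e x p -> f (last x p) <= size p.
  rewrite -[size p]add0n -fx0.
  elim: p (x) => [|z p IHp] w /=; first by rewrite addn0.
  by case/andP=> /lip le_z /IHp; lia.
have walk n z : f z = n -> exists p : n.-tuple T, path e x p && (last x p == z).
  elim: n z => [|n IHn] z fz.
    have [->|/desc[w _]] := eqVneq z x; last by rewrite fz.
    by exists [tuple] => /=.
  have [zx|/desc[w ewz]] := eqVneq z x; first by rewrite zx fx0 in fz.
  rewrite fz => -[/esym/IHn[p /andP[pp /eqP lp]]].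
  by exists [tuple of rcons p z]; rewrite rcons_path last_rcons pp lp ewz eqxx.
(* No walk is shorter than f y, and some walk has that length. *)
rewrite /gdist -(subnKC (ltnW ltfT)) iotaD find_cat ifN; last first.
  apply/hasPn => n; rewrite mem_iota add0n => /= lt_n.
  apply/existsP => -[p /andP[pp /eqP lp]].
  by have := walk_ge _ pp; rewrite lp size_tuple leqNgt lt_n.
rewrite size_iota -[RHS]addn0; congr (_ + _)%N; rewrite add0n.
rewrite -[#|T| - f y]prednK ?subn_gt0 //= ifT //.
by apply/existsP/walk.
Qed.

Variables (Omega : finType) (m : nat).
Hypothesis card_Omega : #|Omega| = (2 * m).+1%N.
Variable x : odd_vertex Omega m.

Lemma card_odd_vertex_gt : m < #|odd_vertex Omega m|.
Proof.
rewrite card_sig -cardsE card_draws card_Omega -(binSn m).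
by apply: leq_bin2l; lia.
Qed.

Lemma odd_adj_meet (y z : odd_vertex Omega m) : odd_adj y z ->
  (m - #|val z :&: val x| - 1 <= #|val y :&: val x| <= m - #|val z :&: val x|)%N.
Proof.
case/odd_adjP => // e ez ->; have := cardsID (val z) (val x).
have : e \notin val z by rewrite -in_setC.
move/(card_setI_remove (val x)); rewrite card_vertex setIC.
by rewrite (setIC (val z)); case: (e \in _); lia.
Qed.

Lemma exists_neighbour (y : odd_vertex Omega m) e : e \notin val y ->
  exists2 z : odd_vertex Omega m, odd_adj z y &
    (#|val z :&: val x| + (e \in val x) = m - #|val y :&: val x|)%N.
Proof.
move=> ey; have cz : #|~: val y :\ e| == m.
  have := cardsD1 e (~: val y); rewrite card_setC_vertex // in_setC ey add1n.
  by case=> <-.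
exists (exist (fun z : {set Omega} => #|z| == m) _ cz).
  by apply/odd_adjP => //; exists e; rewrite ?in_setC.
move: (card_vertex x) ey; rewrite /=.
move: (val x) (val y) => X Y cX ey; rewrite setIC (setIC Y).
have := card_setI_remove X ey; have := cardsID Y X; rewrite cX.
have : ((e \in X) <= #|X :\: Y|)%N.
  case: (boolP (e \in X)) => //= ex; apply/card_gt0P; exists e.
  by rewrite in_setD ey.
by case: (e \in X); lia.
Qed.

(** The distance from x to a vertex meeting it in t points: going to a neighbour
    turns t into m - t or m - t - 1, so two steps change t by at most one. *)
Definition meet_dist t := if 2 * (m - t) <= m then 2 * (m - t) else (2 * t).+1.

Lemma gdist_odd y : gdist (@odd_adj Omega m) x y = meet_dist #|val y :&: val x|.
Proof.
apply: (@gdist_potential _ _ _ (fun y => meet_dist #|val y :&: val x|)).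
- by rewrite setIid card_vertex /meet_dist subnn.
- move=> {}y z /odd_adj_meet; rewrite /meet_dist.
  have := subset_leq_card (subsetIr (val z) (val x)).
  have := subset_leq_card (subsetIr (val y) (val x)).
  rewrite card_vertex; move: #|_ :&: _| #|_ :&: _| => ty tz.
  by do 2!case: ifP; lia.
- move=> {}y yx; set t := #|_ :&: _|.
  have [le|gt] := leqP (2 * (m - t)) m.
    (* At even distance, step back by removing a point of x from ~: y. *)
    have [e] : exists e, e \in val x :\: val y.
      apply/set0Pn; apply: contra_neq yx => /eqP; rewrite setD_eq0 => sxy.
      by apply/val_inj/eqP; rewrite eq_sym eqEcard sxy !card_vertex /=.
    case/setDP => ex ey; have [z ezy cz] := exists_neighbour ey.
    exists z => //; move: cz; rewrite ex -/t /meet_dist.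
    move: t #|_ :&: _| le => ty tz le.
    by do 2!case: ifP; lia.
  (* At odd distance, step back by removing a point outside x from ~: y. *)
  have [e] : exists e, e \in ~: (val x :|: val y).
    apply/card_gt0P; have := cardsC (val x :|: val y).
    by have := cardsUI (val x) (val y); rewrite !card_vertex card_Omega; lia.
  rewrite in_setC in_setU negb_or => /andP[/negbTE ex ey].
  have [z ezy cz] := exists_neighbour ey.
  exists z => //; move: cz; rewrite ex -/t /meet_dist.
  move: t #|_ :&: _| gt => ty tz gt.
  by do 2!case: ifP; lia.
apply: leq_ltn_trans card_odd_vertex_gt; rewrite /meet_dist.
by case: ifP; lia.
Qed.

Lemma in_Gamma y p : p <= m ->
  (y \in Gamma x p) = (#|val y :&: val x| == in_card m p).
Proof.
move=> le_pm; rewrite inE gdist_odd.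
have := subset_leq_card (subsetIr (val y) (val x)); rewrite card_vertex.
move: #|_ :&: _| => t.
by rewrite /meet_dist /in_card; do 2!case: ifP; lia.
Qed.

End Distance.

(** * Orbital matrices and their recurrences *)

Section Orbitals.

Variables (F : numFieldType) (Omega : finType) (m : nat).
Hypothesis card_Omega : #|Omega| = (2 * m).+1%N.
Variable x : odd_vertex Omega m.

Lemma eq_orbit_mx (phi psi : int -> int -> int -> int -> F) :
  (forall a b l s, phi a b l s = psi a b l s) -> orbit_mx x phi = orbit_mx x psi.
Proof. by move=> eq; apply/matrixP => r c; rewrite !mxE /orbit_kernel eq. Qed.

Lemma orbit_mx_comb (phi psi : int -> int -> int -> int -> F) c d :
  c *: orbit_mx x phi + d *: orbit_mx x psi =
  orbit_mx x (fun a b l s => c * phi a b l s + d * psi a b l s).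
Proof. by apply/matrixP => i j; rewrite !mxE. Qed.

(** For realizable sizes, the 0-1 matrix of an orbit on pairs of vertices of the
    group of permutations of Omega that preserve x. *)
Definition orbital_mx (a b l s : int) : 'M[F]_#|odd_vertex Omega m| :=
  orbit_mx x (fun a' b' l' s' => [&& a' == a, b' == b, l' == l & s' == s]%:R).

Definition level_mx (b : int) : 'M[F]_#|odd_vertex Omega m| :=
  \matrix_(r, c) ((r == c) && (#|val (enum_val r) :&: val x|%:Z == b))%:R.

Lemma mul_orbit_level phi b : orbit_mx x phi *m level_mx b =
  orbit_mx x (fun a b' l s => phi a b' l s *+ (b' == b)).
Proof.
apply/matrixP => r c; rewrite !mxE (bigD1 c) //= big1 => [|k kc].
  by rewrite !mxE eqxx addr0 mulr_natr.
by rewrite !mxE (negbTE kc) mulr0.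
Qed.

(** The conditions on the sizes that come from y :&: x and z :&: x being subsets
    of the m-set x, and y :\: x and z :\: x of its complement, of size m + 1. *)
Definition orbital_realizable (a b l s : int) : bool :=
  [&& 0 <= l, l <= a, l <= b, a + b - l <= m%:Z &
   [&& 0 <= s, s <= m%:Z - a, s <= m%:Z - b & m%:Z - a - b - s <= 1]].

Lemma orbital_mx_eq0 a b l s :
  ~~ orbital_realizable a b l s -> orbital_mx a b l s = 0.
Proof.
move=> nreal; apply/matrixP => r c; rewrite !mxE /orbit_kernel.
set y := val (enum_val r); set z := val (enum_val c); set X := val x.
have cy : #|y| = m := card_vertex _; have cz : #|z| = m := card_vertex _.
have cX : #|X| = m := card_vertex x; clearbody X y z.
case: eqP => //= ea; case: eqP => //= eb; case: eqP => //= el.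
case: eqP => //= es; case/negP: nreal; rewrite /orbital_realizable -ea -eb -el -es.
have := cardsID X y; have := cardsID X z; have := cardsID X (y :&: z).
have := subset_leq_card (subsetIr (y :|: z) X); rewrite setIUl.
have := cardsUI (y :&: X) (z :&: X); rewrite -setIIl.
have := subset_leq_card (subsetIr (y :|: z) (~: X)); rewrite -setDE setDUl.
have := cardsUI (y :\: X) (z :\: X); rewrite -setDIl.
have := cardsC X; rewrite card_Omega.
have := subset_leq_card (subsetIl (y :&: X) (z :&: X)); rewrite -setIIl.
have := subset_leq_card (subsetIr (y :&: X) (z :&: X)); rewrite -setIIl.
have := subset_leq_card (subsetIl (y :\: X) (z :\: X)); rewrite -setDIl.
have := subset_leq_card (subsetIr (y :\: X) (z :\: X)); rewrite -setDIl.
rewrite cy cz cX; clear=> *; do !(apply/andP; split); lia.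
Qed.

(** Multiplying by the adjacency matrix and projecting to level m - b keeps the
    neighbours ~: w :\ e with e outside x.  The first term counts the points e
    in y, the second those outside y. *)
Lemma orbital_mx_adj_outer a b l s :
  orbital_mx a b l s *m adj_mx F Omega m *m level_mx (m%:Z - b) =
    (s + 1)%:~R *: orbital_mx a (m%:Z - b) (a - l) (m%:Z - a - s - 1)
  + (m%:Z + 1 - b - s)%:~R *: orbital_mx a (m%:Z - b) (a - l) (m%:Z - a - s).
Proof.
rewrite mul_orbit_adj // mul_orbit_level orbit_mx_comb.
apply: eq_orbit_mx => a' b' l' s'; rewrite /orbit_adj.
have -> : (m%:Z - b' - 1 == b) = (b' == m%:Z - b - 1) by lia.
have -> : (m%:Z - b' == b) = (b' == m%:Z - b) by lia.
have -> : (a' - l' == l) = (l' == a' - l) by lia.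
have -> : (m%:Z - a' - s' - 1 == s) = (s' == m%:Z - a' - s - 1) by lia.
have -> : (m%:Z - a' - s' == s) = (s' == m%:Z - a' - s) by lia.
have [->|] := eqVneq a' a; last by rewrite /= !mul0rz !addr0 mul0rn !mulr0 addr0.
have [->|_] := eqVneq b' (m%:Z - b); last by rewrite /= mulr0n !mulr0 addr0.
have -> : (m%:Z - b == m%:Z - b - 1) = false by lia.
have [->|_] := eqVneq l' (a - l); last first.
  by rewrite /= !mul0rz !addr0 mul0rn !mulr0 addr0.
rewrite /= !mul0rz !add0r mulr1n !mulrzl.
have [->|_] := eqVneq s' (m%:Z - a - s - 1); rewrite ?mul0rz ?add0r.
  have -> : (m%:Z - a - s - 1 == m%:Z - a - s) = false by lia.
  by rewrite /= !mul0rz; congr (_ *~ _ + _); lia.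
have [->|_] := eqVneq s' (m%:Z - a - s); rewrite ?mul0rz //.
by congr (_ *~ _); lia.
Qed.

(** The companion of the preceding identity for the points e of x. *)
Lemma orbital_mx_adj_inner a b l s :
  orbital_mx a b l s *m adj_mx F Omega m *m level_mx (m%:Z - b - 1) =
    (l + 1)%:~R *: orbital_mx a (m%:Z - b - 1) (a - l - 1) (m%:Z - a - s)
  + (b + 1 - l)%:~R *: orbital_mx a (m%:Z - b - 1) (a - l) (m%:Z - a - s).
Proof.
rewrite mul_orbit_adj // mul_orbit_level orbit_mx_comb.
apply: eq_orbit_mx => a' b' l' s'; rewrite /orbit_adj.
have -> : (m%:Z - b' - 1 == b) = (b' == m%:Z - b - 1) by lia.
have -> : (m%:Z - b' == b) = (b' == m%:Z - b) by lia.
have -> : (a' - l' - 1 == l) = (l' == a' - l - 1) by lia.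
have -> : (a' - l' == l) = (l' == a' - l) by lia.
have -> : (m%:Z - a' - s' == s) = (s' == m%:Z - a' - s) by lia.
have [->|] := eqVneq a' a; last by rewrite /= !mul0rz !addr0 mul0rn !mulr0 addr0.
have [->|_] := eqVneq b' (m%:Z - b - 1); last by rewrite /= mulr0n !mulr0 addr0.
have -> : (m%:Z - b - 1 == m%:Z - b) = false by lia.
have [->|_] := eqVneq s' (m%:Z - a - s); last first.
  by rewrite !andbF /= !mul0rz !addr0 mul0rn !mulr0 addr0.
rewrite /= !mul0rz !addr0 mulr1n !mulrzl !andbT.
have [->|_] := eqVneq l' (a - l - 1); rewrite ?mul0rz ?add0r.
  have -> : (a - l - 1 == a - l) = false by lia.
  by rewrite /= !mul0rz; congr (_ *~ _ + _); lia.
have [->|_] := eqVneq l' (a - l); rewrite ?mul0rz //.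
by congr (_ *~ _); lia.
Qed.

End Orbitals.

(** * Subalgebras containing the generators contain every orbital *)

Lemma int_ind_down (P : int -> Prop) (n : int) :
    (forall s, n <= s -> P s) ->
    (forall s, s <= n -> (forall t, s <= t -> P t) -> P (s - 1)) ->
  forall s, P s.
Proof.
move=> base step s; have [k] : exists k : nat, n - k%:Z <= s.
  by exists `|n - s|%N; lia.
elim: k s => [|k IHk] s le_s; first by apply: base; lia.
have [le|lt] := lerP (n - k%:Z) s; first exact: IHk.
have -> : s = s + 1 - 1 by ring.
by apply: step => [|t le_t]; [lia|apply: IHk; lia].
Qed.

Lemma int_ind_up (P : int -> Prop) (n : int) :
    (forall s, s < n -> P s) -> (forall s, n <= s -> P (s - 1) -> P s) ->
  forall s, P s.
Proof.
move=> base step s; have [k] : exists k : nat, s < n + k%:Z.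
  by exists `|s - n|.+1%N; lia.
elim: k s => [|k IHk] s lt_s; first by apply: base; lia.
have [le|lt] := lerP n s; last exact: base.
by apply: step => //; apply: IHk; lia.
Qed.

Lemma subalgebra0 (F : fieldType) n (S : set 'M[F]_n) : is_subalgebra S -> S 0.
Proof. by case=> S1 S_lin _; have := S_lin (-1) _ _ S1 S1; rewrite scaleN1r addNr. Qed.

Section Generation.

Variables (F : numFieldType) (Omega : finType) (m : nat).
Hypothesis card_Omega : #|Omega| = (2 * m).+1%N.
Variable x : odd_vertex Omega m.
Variable S : set 'M[F]_#|odd_vertex Omega m|.
Hypothesis subalgS : is_subalgebra S.
Hypothesis S_adj : S (adj_mx F Omega m).
Hypothesis S_level : forall b, S (level_mx F x b).
Local Notation O := (orbital_mx F x).

Let S_lin a M N : S M -> S N -> S (a *: M + N).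
Proof. by case: subalgS => _ + _; apply. Qed.
Let S_mul M N : S M -> S N -> S (M *m N).
Proof. by case: subalgS => _ _; apply. Qed.
Let S0 : S 0.
Proof. exact: subalgebra0. Qed.
Let SZ a M : S M -> S (a *: M).
Proof. by move=> SM; rewrite -[_ *: M]addr0; apply: S_lin. Qed.
Let SD M N : S M -> S N -> S (M + N).
Proof. by move=> SM SN; rewrite -[M]scale1r; apply: S_lin. Qed.

(* How a recurrence is solved for one of its terms. *)
Let S_solve (c : int) M N : c != 0 -> S (c%:~R *: M + N) -> S N -> S M.
Proof.
move=> c0 SMN SN; have -> : M = c%:~R^-1 *: (-1 *: N + (c%:~R *: M + N)).
  by rewrite scaleN1r addrCA addNr addr0 scalerA mulVf ?scale1r // intr_eq0.
by apply/SZ/S_lin.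
Qed.

Let S_orbital_eq0 a b l s : ~~ orbital_realizable m a b l s -> S (O a b l s).
Proof. by move=> nr; rewrite orbital_mx_eq0. Qed.

Let S_outer a b l s : S (O a b l s) ->
  S ((s + 1)%:~R *: O a (m%:Z - b) (a - l) (m%:Z - a - s - 1)
     + (m%:Z + 1 - b - s)%:~R *: O a (m%:Z - b) (a - l) (m%:Z - a - s)).
Proof.
by rewrite -orbital_mx_adj_outer // => SO; apply: (S_mul (S_mul _ _)).
Qed.

Let S_inner a b l s : S (O a b l s) ->
  S ((l + 1)%:~R *: O a (m%:Z - b - 1) (a - l - 1) (m%:Z - a - s)
     + (b + 1 - l)%:~R *: O a (m%:Z - b - 1) (a - l) (m%:Z - a - s)).
Proof.
by rewrite -orbital_mx_adj_inner // => SO; apply: (S_mul (S_mul _ _)).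
Qed.

(** Going from level a to level m - a and back complements twice and removes a
    point outside x each time: the result is a three-term recurrence in s, where
    the coefficient of [O a a l (s - 1)] is the square of m + 1 - a - s. *)
Lemma diag_outer_down a l : S (O a a l (m%:Z - a)) -> forall s, S (O a a l s).
Proof.
move=> S_top; apply: (@int_ind_down _ (m%:Z - a)) => [s le_s|s le_s IH].
  have [->//|ne] := eqVneq s (m%:Z - a).
  by apply: S_orbital_eq0; rewrite /orbital_realizable; lia.
have Ss := IH s (lexx s); have Ss1 : S (O a a l (s + 1)) by apply: IH; lia.
have := S_mul (S_mul (S_outer Ss) S_adj) (S_level (m%:Z - (m%:Z - a))).
rewrite !mulmxDl -!scalemxAl !orbital_mx_adj_outer //.
have -> : m%:Z - (m%:Z - a) = a by ring.
have -> : a - (a - l) = l by ring.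
have -> : m%:Z - a - (m%:Z - a - s - 1) - 1 = s by ring.
have -> : m%:Z - a - (m%:Z - a - s - 1) = s + 1 by ring.
have -> : m%:Z - a - (m%:Z - a - s) = s by ring.
have top_neq0 : m%:Z + 1 - a - s != 0 by lia.
rewrite addrC => /(S_solve top_neq0)/(_ (SZ _ (SD (SZ _ Ss) (SZ _ Ss1)))) SM.
by apply: (S_solve _ SM (SZ _ Ss)); lia.
Qed.

(** The same recurrence for points inside x, through level m - a - 1: the
    coefficient of [O a a (l - 1) s] is the square of a + 1 - l. *)
Lemma diag_inner_down a s :
  (forall l, a <= l -> S (O a a l s)) -> forall l, S (O a a l s).
Proof.
move=> S_top; apply: (int_ind_down S_top) => l le_l IH.
have Sl := IH l (lexx l); have Sl1 : S (O a a (l + 1) s) by apply: IH; lia.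
have := S_mul (S_mul (S_inner Sl) S_adj) (S_level (m%:Z - (m%:Z - a - 1) - 1)).
rewrite !mulmxDl -!scalemxAl !orbital_mx_adj_inner //.
have -> : m%:Z - (m%:Z - a - 1) - 1 = a by ring.
have -> : m%:Z - a - (m%:Z - a - s) = s by ring.
have -> : a - (a - l - 1) - 1 = l by ring.
have -> : a - (a - l - 1) = l + 1 by ring.
have -> : a - (a - l) = l by ring.
have top_neq0 : a + 1 - l != 0 by lia.
rewrite addrC => /(S_solve top_neq0)/(_ (SZ _ (SD (SZ _ Sl) (SZ _ Sl1)))) SM.
by apply: (S_solve _ SM (SZ _ Sl)); lia.
Qed.

(** Two vertices of level a are equal as soon as they share a points of x and
    m - a points outside it. *)
Lemma level_orbital a : level_mx F x a = O a a a (m%:Z - a).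
Proof.
apply/matrixP => r c; rewrite !mxE /orbit_kernel; congr ((nat_of_bool _)%:R).
have [<-{c}|ne] := eqVneq r c.
  have cy := card_vertex (enum_val r); move: (val (enum_val r)) (val x) cy => y X cy.
  have := cardsID X y; rewrite setIid cy => cyX.
  by case: eqP => //= <-; apply/esym/eqP; lia.
rewrite andFb; apply/esym/negbTE/negP.
case/and4P=> _ _ /eqP el /eqP es; case/eqP: ne; apply/enum_val_inj/val_inj.
have := cardsID (val x) (val (enum_val r) :&: val (enum_val c)).
set y := val (enum_val r) in el es *; set z := val (enum_val c) in el es * => cyz.
have cy : #|y| = m := card_vertex _; have cz : #|z| = m := card_vertex _.
have cI : #|y :&: z| = m by rewrite -cyz; lia.
have /eqP <- : y :&: z == y by rewrite eqEcard subsetIl cI cy /=.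
by apply/eqP; rewrite eqEcard subsetIr cI cz /=.
Qed.

Lemma diag_orbital a l s : S (O a a l s).
Proof.
apply: diag_inner_down => {}l le_l.
have [->|ne] := eqVneq l a; last first.
  by apply: S_orbital_eq0; rewrite /orbital_realizable; lia.
by apply: diag_outer_down; rewrite -level_orbital.
Qed.

(** The recurrences are solved from the end where the realizability conditions
    force a zero: s < 0 at level m - b, then l >= a at level b - 1 < a.  The
    coefficient solved for in the first is 1 + a - b + s, nonzero for s >= 0
    because b <= a. *)
Lemma orbital_step_down a b : b <= a ->
  (forall l s, S (O a b l s)) -> forall l s, S (O a (b - 1) l s).
Proof.
move=> le_ba Sb.
have Smid l : forall s, S (O a (m%:Z - b) l s).
  apply: (@int_ind_up _ 0) => [s lt_s|s le_s IH].
    by apply: S_orbital_eq0; rewrite /orbital_realizable; lia.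
  have := S_outer (Sb (a - l) (m%:Z - a - s)).
  have -> : a - (a - l) = l by ring.
  have -> : m%:Z - a - (m%:Z - a - s) = s by ring.
  by rewrite addrC => /S_solve; apply; [lia|apply: SZ].
move=> l s; move: l; apply: (@int_ind_down _ a) => [l le_l|l le_l IH].
  by apply: S_orbital_eq0; rewrite /orbital_realizable; lia.
have := S_inner (Smid (a - l) (m%:Z - a - s)).
have -> : m%:Z - (m%:Z - b) - 1 = b - 1 by ring.
have -> : a - (a - l) = l by ring.
have -> : m%:Z - a - (m%:Z - a - s) = s by ring.
by move/S_solve; apply; [lia|apply/SZ/IH].
Qed.

(** Here the zeros are at l < 0 on level m - b - 1, where the coefficient
    b + 1 - a + l is nonzero because a <= b, and then at s >= m - a on level
    b + 1 > a. *)
Lemma orbital_step_up a b : a <= b ->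
  (forall l s, S (O a b l s)) -> forall l s, S (O a (b + 1) l s).
Proof.
move=> le_ab Sb.
have Smid s : forall l, S (O a (m%:Z - b - 1) l s).
  apply: (@int_ind_up _ 0) => [l lt_l|l le_l IH].
    by apply: S_orbital_eq0; rewrite /orbital_realizable; lia.
  have := S_inner (Sb (a - l) (m%:Z - a - s)).
  have -> : a - (a - l) = l by ring.
  have -> : m%:Z - a - (m%:Z - a - s) = s by ring.
  by rewrite addrC => /S_solve; apply; [lia|apply: SZ].
move=> l; apply: (@int_ind_down _ (m%:Z - a)) => [s le_s|s le_s IH].
  by apply: S_orbital_eq0; rewrite /orbital_realizable; lia.
have := S_outer (Smid (m%:Z - a - s) (a - l)).
have -> : m%:Z - (m%:Z - b - 1) = b + 1 by ring.
have -> : a - (a - l) = l by ring.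
have -> : m%:Z - a - (m%:Z - a - s) = s by ring.
by move/S_solve; apply; [lia|apply/SZ/IH].
Qed.

Lemma orbital_in_subalgebra a b l s : S (O a b l s).
Proof.
have [le_ba|lt_ab] := lerP b a.
  move: b le_ba l s; suff : forall b, b <= a -> forall l s, S (O a b l s) by [].
  apply: (@int_ind_down _ a) => [b le_b ge_b l s|b le_b IH _].
    have -> : b = a by lia.
    exact: diag_orbital.
  by apply: orbital_step_down => //; apply: IH.
move: (ltW lt_ab) l s => {lt_ab}; move: b.
suff : forall b, a <= b -> forall l s, S (O a b l s) by [].
apply: (@int_ind_up _ (a + 1)) => [b lt_b ge_b l s|b le_b IH _].
  have -> : b = a by lia.
  exact: diag_orbital.
have -> : b = b - 1 + 1 by ring.
by apply: orbital_step_up; [lia|apply: IH; lia].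
Qed.

End Generation.

(** * The space M as the span of the orbitals *)

Lemma relabel_mx_matched (F : fieldType) (T U : eqType) (m n m' n' : nat)
    (f : 'I_m -> T) (g : 'I_n -> U) (f' : 'I_m' -> T) (g' : 'I_n' -> U)
    (M : 'M[F]_(m, n)) r c r' c' :
    injective f -> injective g -> f r = f' r' -> g c = g' c' ->
  relabel_mx f g f' g' M r' c' = M r c.
Proof.
rewrite mxE => finj ginj <- <-; rewrite (big_pred1 r) => [|i]; last exact: inj_eq.
by rewrite (big_pred1 c) => [//|j]; apply: inj_eq.
Qed.

Lemma relabel_mx_unmatched (F : fieldType) (T U : eqType) (m n m' n' : nat)
    (f : 'I_m -> T) (g : 'I_n -> U) (f' : 'I_m' -> T) (g' : 'I_n' -> U)
    (M : 'M[F]_(m, n)) r' c' :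
    (forall r, f r != f' r') \/ (forall c, g c != g' c') ->
  relabel_mx f g f' g' M r' c' = 0.
Proof.
rewrite mxE; case=> [nof|nog].
  by apply: big_pred0 => r; apply/negbTE/nof.
by apply: big1 => r _; apply: big_pred0 => c; apply/negbTE/nog.
Qed.

(** A set is determined by its traces on V and on the complement of V. *)
Lemma tens_label_inj (Omega : finType) (V : {set Omega}) (a c : nat) :
  injective (@tens_label Omega (ksubsets V a) (ksubsets (~: V) c)).
Proof.
have inter (k : 'I_(#|ksubsets V a| * #|ksubsets (~: V) c|)) :
    tens_label k :&: V = enum_val (mxtens_unindex k).1 /\
    tens_label k :\: V = enum_val (mxtens_unindex k).2.
  have := enum_valP (mxtens_unindex k).1; have := enum_valP (mxtens_unindex k).2.
  rewrite !inE /tens_label => /andP[sQ _] /andP[sP _].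
  have dQ : [disjoint enum_val (mxtens_unindex k).2 & V].
    by rewrite disjoints_subset.
  rewrite setIUl setDUl (setIidPl sP) (setDidPl dQ) (disjoint_setI0 dQ) setU0.
  by move: sP; rewrite -setD_eq0 => /eqP ->; rewrite set0U.
move=> i j eqij; have [i1 i2] := inter i; have [j1 j2] := inter j.
rewrite -(mxtens_unindexK i) -(mxtens_unindexK j); congr mxtens_index.
rewrite [LHS]surjective_pairing [RHS]surjective_pairing.
by congr pair; apply: enum_val_inj; [rewrite -i1 -j1 eqij|rewrite -i2 -j2 eqij].
Qed.

Section MSpace.

Variables (F : numFieldType) (Omega : finType) (m : nat).
Hypothesis card_Omega : #|Omega| = (2 * m).+1%N.
Variable x : odd_vertex Omega m.
Local Notation O := (orbital_mx F x).

Lemma Estar_level p : (p <= m)%N -> Estar F x p = level_mx F x (in_card m p).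
Proof. by move=> le_pm; apply/matrixP => r c; rewrite !mxE in_Gamma. Qed.

Lemma out_cardE p : (p <= m)%N -> out_card m p = (m - in_card m p)%N.
Proof. by move=> le_pm; rewrite /out_card /in_card; case: ifP; lia. Qed.

Lemma in_card_meet_dist a : (a <= m)%N ->
  (meet_dist m a <= m)%N /\ in_card m (meet_dist m a) = a.
Proof. by move=> le_am; rewrite /meet_dist /in_card; do 2!case: ifP; lia. Qed.

Lemma parts_ksubsets p y : (p <= m)%N -> y \in Gamma x p ->
  val y :&: val x \in ksubsets (val x) (in_card m p) /\
  val y :\: val x \in ksubsets (~: val x) (out_card m p).
Proof.
move=> le_pm; rewrite in_Gamma // out_cardE // => /eqP <-; rewrite !inE subsetIr eqxx.
split=> //; rewrite setDE subsetIr -setDE andTb.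
have := cardsID (val x) (val y); rewrite card_vertex.
by move: #|_ :&: _| #|_ :\: _| => i o; lia.
Qed.

Lemma Lmx_HH p q l s : (p <= m)%N -> (q <= m)%N ->
  Lmx (HH_mx F x p q (in_card m p) (in_card m q)
         (out_card m p) (out_card m q) l s) = O (in_card m p) (in_card m q) l s.
Proof.
move=> le_pm le_qm; apply/matrixP => r c; rewrite [RHS]mxE /orbit_kernel.
set y := enum_val r; set z := enum_val c; rewrite !eqz_nat.
have [yp|yp] := boolP (y \in Gamma x p); last first.
  rewrite /Lmx relabel_mx_unmatched.
    by move: yp; rewrite in_Gamma // => /negbTE ->.
  by left=> r0; apply: contraNneq yp; rewrite -/y => <-; apply: enum_valP.
have [zq|zq] := boolP (z \in Gamma x q); last first.
  rewrite /Lmx relabel_mx_unmatched.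
    by move: zq; rewrite in_Gamma // => /negbTE ->; rewrite andbF.
  by right=> c0; apply: contraNneq zq; rewrite -/z => <-; apply: enum_valP.
rewrite /Lmx (@relabel_mx_matched _ _ _ _ _ _ _ _ _ _ _ _
  (enum_rank_in yp y) (enum_rank_in zq z)) ?enum_rankK_in //; try exact: enum_val_inj.
have [y1 y2] := parts_ksubsets le_pm yp; have [z1 z2] := parts_ksubsets le_qm zq.
rewrite /HH_mx (@relabel_mx_matched _ _ _ _ _ _ _ _ _ _ _ _
  (mxtens_index (enum_rank_in y1 (val y :&: val x),
                 enum_rank_in y2 (val y :\: val x)))
  (mxtens_index (enum_rank_in z1 (val z :&: val x),
                 enum_rank_in z2 (val z :\: val x))));
  try exact: tens_label_inj; last first.
- by rewrite /tens_label /vertex_label mxtens_indexK /= !enum_rankK_in // setID.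
- by rewrite /tens_label /vertex_label mxtens_indexK /= !enum_rankK_in // setID.
rewrite tensmxE !mxE !enum_rankK_in // -setIIl -setDIl -natrM mulnb.
by move: yp zq; rewrite !in_Gamma // => -> ->.
Qed.

Lemma orbital_in_Mspace a b l s : O a b l s \in Mspace F x.
Proof.
have [real|nreal] := boolP (orbital_realizable m a b l s); last first.
  by rewrite orbital_mx_eq0 // mem0v.
have [a' ea] : exists a' : nat, a = a'.
  by exists `|a|%N; move: real; rewrite /orbital_realizable; lia.
have [b' eb] : exists b' : nat, b = b'.
  by exists `|b|%N; move: real; rewrite /orbital_realizable; lia.
have [l' el] : exists l' : nat, l = l'.
  by exists `|l|%N; move: real; rewrite /orbital_realizable; lia.
have [s' es] : exists s' : nat, s = s'.
  by exists `|s|%N; move: real; rewrite /orbital_realizable; lia.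
move: real; rewrite {a}ea {b}eb {l}el {s}es => real.
have [] : (a' <= m /\ b' <= m)%N.
  by move: real; rewrite /orbital_realizable; split; lia.
move=> /in_card_meet_dist[pm pa] /in_card_meet_dist[qm qb].
set p := meet_dist m a' in pm pa; set q := meet_dist m b' in qm qb.
pose pq := (Ordinal (pm : p < m.+1)%N, Ordinal (qm : q < m.+1)%N).
apply: (subvP (sumv_sup pq isT (subvv _))).
apply/memv_imgP => /=; exists (HH_mx F x p q (in_card m p) (in_card m q)
  (out_card m p) (out_card m q) l' s'); last by rewrite LmxE Lmx_HH // pa qb.
apply: memv_span; apply: allpairs_f; rewrite mem_index_iota ?out_cardE // pa qb;
  move: real; rewrite /orbital_realizable; lia.
Qed.

Lemma Mspace_ind (Q : 'M[F]_#|odd_vertex Omega m| -> Prop) :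
    Q 0 -> (forall c M N, Q M -> Q N -> Q (c *: M + N)) ->
    (forall a b l s, Q (O a b l s)) ->
  forall N, N \in Mspace F x -> Q N.
Proof.
move=> Q0 Qlin QO.
have Qsum (I : finType) (P : pred I) f :
    (forall i, P i -> Q (f i)) -> Q (\sum_(i | P i) f i).
  move=> Qf; apply: (big_ind Q) => // M N QM QN.
  by rewrite -[M]scale1r; apply: Qlin.
move=> _ /memv_sumP[B inB ->]; apply: (Qsum) => -[p q] _.
have /memv_imgP[M inM ->] := inB (p, q) isT.
pose L := [seq HH_mx F x p q (in_card m p) (in_card m q) (out_card m p)
  (out_card m q) l s | l <- Grange (in_card m p) (in_card m q) m,
                       s <- Grange (out_card m p) (out_card m q) m.+1].
rewrite (@coord_span _ _ _ (in_tuple L) _ inM) linear_sum.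
apply: (Qsum) => i _; rewrite linearZZ -[_ *: _]addr0; apply: Qlin => //.
have le_pm : (p <= m)%N by rewrite -ltnS.
have le_qm : (q <= m)%N by rewrite -ltnS.
have /allpairsP[[l s] [_ _ Li]] : L`_i \in L := mem_nth 0 (ltn_ord i).
by rewrite Li /= LmxE Lmx_HH.
Qed.

(** A neighbour of a vertex of level b is of level m - b or m - b - 1. *)
Lemma orbital_mx_mul_adj a b l s : O a b l s *m adj_mx F Omega m =
  O a b l s *m adj_mx F Omega m *m level_mx F x (m%:Z - b) +
  O a b l s *m adj_mx F Omega m *m level_mx F x (m%:Z - b - 1).
Proof.
rewrite mul_orbit_adj // !mul_orbit_level -[X in X + _]scale1r -[X in _ + X]scale1r.
rewrite orbit_mx_comb; apply: eq_orbit_mx => a' b' l' s'; rewrite !mul1r.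
have [->|ne] := eqVneq b' (m%:Z - b).
  have -> : (m%:Z - b == m%:Z - b - 1) = false by lia.
  by rewrite addr0.
have [->|ne'] := eqVneq b' (m%:Z - b - 1); first by rewrite add0r.
rewrite /orbit_adj.
have -> : (m%:Z - b' - 1 == b) = false by lia.
have -> : (m%:Z - b' == b) = false by lia.
by rewrite !andbF !mul0rz !addr0.
Qed.

Lemma orbital_mx_mul_level a b l s b' :
  O a b l s *m level_mx F x b' = if b == b' then O a b l s else 0.
Proof.
rewrite mul_orbit_level; case: eqVneq => [->|ne].
  apply: eq_orbit_mx => a1 b1 l1 s1.
  by case: (eqVneq b1 b') => _; rewrite // andbF.
apply/matrixP => r c; rewrite !mxE /orbit_kernel.
by case: (eqVneq _ b') => [->|_] //; rewrite (eq_sym b') (negbTE ne) andbF.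
Qed.

Lemma one_in_Mspace : 1%:M \in Mspace F x.
Proof.
have -> : 1%:M = \sum_(a < m.+1) level_mx F x a%:Z.
  apply/matrixP => r c; rewrite summxE !mxE.
  have le_m : (#|val (enum_val r) :&: val x| < m.+1)%N.
    have := subset_leq_card (subsetIr (val (enum_val r)) (val x)).
    by rewrite card_vertex ltnS.
  rewrite (bigD1 (Ordinal le_m)) //= !mxE eqxx andbT big1 ?addr0 // => a ne.
  rewrite mxE; case: (eqVneq _ a%:Z) => [ea|_]; last by rewrite andbF.
  by case/eqP: ne; apply: val_inj; case: ea.
by apply: memv_suml => a _; rewrite level_orbital // orbital_in_Mspace.
Qed.

Lemma Mspace_mul_closed (C : 'M[F]_#|odd_vertex Omega m|) :
    (forall a b l s, O a b l s *m C \in Mspace F x) ->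
  forall N, N \in Mspace F x -> N *m C \in Mspace F x.
Proof.
move=> OC; apply: Mspace_ind => [|c M N MC NC|//]; first by rewrite mul0mx mem0v.
by rewrite mulmxDl -scalemxAl rpredD // rpredZ.
Qed.

(** The matrices that map M to itself by right multiplication form an algebra,
    and M contains the identity: it is enough to see that the generators of the
    Terwilliger algebra map M to itself. *)
Lemma terwilliger_sub_Mspace B : terwilliger F x B -> B \in Mspace F x.
Proof.
move=> TB; rewrite -[B]mul1mx; move: one_in_Mspace; move: (1%:M).
suff : forall N, N \in Mspace F x -> N *m B \in Mspace F x by [].
apply: (TB (fun C => forall N, N \in Mspace F x -> N *m C \in Mspace F x)).
split; first split.
- by move=> N; rewrite mulmx1.
- move=> c C D SC SD N MN; rewrite mulmxDr -scalemxAr.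
  by rewrite rpredD ?rpredZ ?SC ?SD.
- by move=> C D SC SD N MN; rewrite mulmxA; apply/SD/SC.
move=> C [->|[i ->]]; apply: Mspace_mul_closed => a b l s.
  rewrite orbital_mx_mul_adj orbital_mx_adj_outer // orbital_mx_adj_inner //.
  by rewrite !rpredD ?rpredZ ?orbital_in_Mspace.
rewrite Estar_level -1?ltnS // orbital_mx_mul_level.
by case: ifP; rewrite ?mem0v ?orbital_in_Mspace.
Qed.

Lemma Mspace_sub_terwilliger B : B \in Mspace F x -> terwilliger F x B.
Proof.
move=> MB S [subalgS gensS].
have S_lin c M N : S M -> S N -> S (c *: M + N) by case: subalgS => _ + _; apply.
have S0 := subalgebra0 subalgS.
apply: Mspace_ind MB => // a b l s; apply: orbital_in_subalgebra => //.
  by apply: gensS; left.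
move=> c; have [real|nreal] := boolP (orbital_realizable m c c c (m%:Z - c)).
  have [p [le_pm <-]] : exists p, (p <= m)%N /\ (in_card m p)%:Z = c.
    have le_cm : (`|c| <= m)%N by move: real; rewrite /orbital_realizable; lia.
    exists (meet_dist m `|c|%N); have [-> ->] := in_card_meet_dist le_cm.
    by split=> //; move: real; rewrite /orbital_realizable; lia.
  rewrite -Estar_level //; apply: gensS; right.
  by exists (Ordinal (le_pm : p < m.+1)%N).
(* Off the levels 0, ..., m the projection is zero. *)
by rewrite level_orbital // orbital_mx_eq0.
Qed.

End MSpace.

Local Open Scope classical_set_scope.
Local Open Scope complex_scope.

Theorem theorem3p5 (R : realType) (Omega : finType) (m : nat)
    (m_gt0 : (0 < m)%N) (card_Omega : #|Omega| = (2 * m).+1%N)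
    (x : odd_vertex Omega m) :
  terwilliger R[i] x = [set B | B \in Mspace R[i] x].
Proof.
apply/seteqP; split=> B; first exact: terwilliger_sub_Mspace.
exact: Mspace_sub_terwilliger.
Qed.
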